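(* Let $(X,f_{1,\infty})$ be a nonautonomous dynamical system, and let $K$ be a nonempty subset of $X$. If the sequence of maps $f_{1,\infty}$ has period $k$, then $$D(f_{1,\infty}^k,K)=D(f_{1,\infty},K).$$
   Context: A nonautonomous dynamical system $(X,f_{1,\infty})$ consists of a compact topological space $X$ and a sequence $f_{1,\infty}=(f_i)_{i\ge 1}$ of continuous maps $f_i:X\to X$. Put $f_i^0=\mathrm{id}_X$ and $f_i^j=f_{i+j-1}\circ\cdots\circ f_{i+1}\circ f_i$. For an integer $k\ge1$, $f_{1,\infty}^k$ denotes the sequence of maps $(f_1^k,f_{k+1}^k,f_{2k+1}^k,\dots)$. The sequence $f_{1,\infty}$ has period $k$ if $f_{1,\infty}=(f_1,\dots,f_k,f_1,\dots,f_k,\dots)$, i.e. $f_{i+k}=f_i$ for all $i\ge1$. Pesin topological entropy dimension of a sequence $g_{1,\infty}=(g_i)_{i\ge1}$ of continuous selfmaps of $X$ on nonempty $K\subseteq X$ (applied above to $g_{1,\infty}=f_{1,\infty}$ and $f_{1,\infty}^k$). Put $g_1^0=\mathrm{id}_X$, $g_1^j=g_j\circ\cdots\circ g_1$. For a finite open cover $\mathcal{U}$ of $X$, let $S(\mathcal{U})$ be the set of all finite strings $\mathbf{U}=(U_{i_0},\dots,U_{i_{m-1}})$ of elements of $\mathcal{U}$, with length $m(\mathbf{U})=m$, and let $X(\mathbf{U})=\{x\in X: g_1^j(x)\in U_{i_j},\ 0\le j\le m(\mathbf{U})-1\}$. A collection $\mathcal{G}\subseteq S(\mathcal{U})$ covers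 $K$ if $K\subseteq\bigcup_{\mathbf{U}\in\mathcal{G}}X(\mathbf{U})$. For $\alpha\in\mathbb{R}$, $s>0$ let $M(g_{1,\infty},K,s,\mathcal{U},\alpha,N)=\inf_{\mathcal{G}}\sum_{\mathbf{U}\in\mathcal{G}}e^{-\alpha m(\mathbf{U})^s}$, the infimum over all finite or countable $\mathcal{G}\subseteq S(\mathcal{U})$ covering $K$ with $m(\mathbf{U})\ge N$ for all $\mathbf{U}\in\mathcal{G}$. Let $m(g_{1,\infty},K,s,\mathcal{U},\alpha)=\lim_{N\to\infty}M(g_{1,\infty},K,s,\mathcal{U},\alpha,N)$, $D(g_{1,\infty},K,s,\mathcal{U})=\inf\{\alpha: m(g_{1,\infty},K,s,\mathcal{U},\alpha)=0\}=\sup\{\alpha: m(g_{1,\infty},K,s,\mathcal{U},\alpha)=\infty\}$, and $D(g_{1,\infty},K,s)=\sup_{\mathcal{U}}D(g_{1,\infty},K,s,\mathcal{U})$ over finite open covers $\mathcal{U}$ of $X$. Then $D(g_{1,\infty},K)=\sup\{s>0:D(g_{1,\infty},K,s)=+\infty\}=\inf\{s>0:D(g_{1,\infty},K,s)=0\}$, with $\inf\emptyset=+\infty$ and $\sup\emptyset=0$ for sets of $s>0$. *)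

(* Defs.v *)
From HB Require Import structures.
From mathcomp Require Import all_boot all_order all_algebra.
From mathcomp Require Import all_classical all_reals all_analysis.

Set Implicit Arguments.
Unset Strict Implicit.
Unset Printing Implicit Defensive.

Import Order.TTheory GRing.Theory Num.Theory.
Import numFieldNormedType.Exports.

Local Open Scope classical_set_scope.
Local Open Scope ring_scope.

(* Sequences of maps are indexed from 0: [f i] is the map usually written
   f_{i+1}, so [seqcomp f i j] is f_{i+1}^j = f_{i+j} o ... o f_{i+1}. *)
Fixpoint seqcomp (X : Type) (f : nat -> X -> X) (i j : nat) : X -> X :=
  if j is j'.+1 then f (i + j')%N \o seqcomp f i j' else id.

(* (f_1^k, f_{k+1}^k, f_{2k+1}^k, ...) *)
Definition seqpow (X : Type) (f : nat -> X -> X) (k : nat) : nat -> X -> X :=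
  fun n => seqcomp f (n * k)%N k.

Definition has_period (X : Type) (f : nat -> X -> X) (k : nat) : Prop :=
  (0 < k)%N /\ forall i, f (i + k)%N = f i.

Section entropy_dimension.
Context {R : realType} {X : topologicalType}.
Implicit Types (g : nat -> X -> X) (K : set X) (U : set (set X)).

Definition finite_open_cover U : Prop :=
  [/\ finite_set U, U `<=` open & \bigcup_(V in U) V = [set: X]].

Definition strings U : set (seq (set X)) :=
  [set w | forall V, V \in w -> U V].

Definition string_set g (w : seq (set X)) : set X :=
  [set x | forall j, (j < size w)%N -> nth set0 w j (seqcomp g 0 j x)].

Definition covering_families g K U (N : nat) : set (set (seq (set X))) :=
  [set G | [/\ countable G, G `<=` strings U,
               K `<=` \bigcup_(w in G) string_set g w &
               forall w, G w -> (N <= size w)%N]].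

Definition entropy_premeasure g K (s : R) U (alpha : R) (N : nat) : \bar R :=
  ereal_inf [set \esum_(w in G) (expR (- alpha * (size w)%:R `^ s))%:E |
             G in covering_families g K U N].

Definition entropy_measure g K (s : R) U (alpha : R) : \bar R :=
  limn (entropy_premeasure g K s U alpha).

Definition entropy_cover g K (s : R) U : \bar R :=
  ereal_inf [set alpha%:E | alpha in
             [set alpha : R | entropy_measure g K s U alpha = 0%E]].

Definition entropy_order g K (s : R) : \bar R :=
  ereal_sup [set entropy_cover g K s U | U in finite_open_cover].

(* Of the two equal expressions for the critical exponent this is the
   infimum; [ereal_inf set0 = +oo] is the intended convention. *)
Definition entropy_dim g K : \bar R :=
  ereal_inf [set s%:E | s in [set s : R | 0 < s /\ entropy_order g K s = 0%E]].

End entropy_dimension.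

Arguments entropy_dim R {X} g K.

(* Main.v *)
Require Import Defs.
From HB Require Import structures.
From mathcomp Require Import all_boot all_order all_algebra.
From mathcomp Require Import all_classical all_reals all_analysis.
From mathcomp Require Import zify.

Set Implicit Arguments.
Unset Strict Implicit.
Unset Printing Implicit Defensive.

Import Order.TTheory GRing.Theory Num.Theory.
Import numFieldNormedType.Exports.

Local Open Scope classical_set_scope.
Local Open Scope ring_scope.

(** The order of f^k and the order of f differ, for each exponent s, only by the
    finite positive factor k^s, so they vanish for the same s and the critical
    exponents agree.

    The comparison is by recoding strings. Suppose that strings w over a cover
    U for g can be turned into strings phi w over a cover V for h so that every
    point following w also follows phi w, and |w| <= r |phi w|. Then a family
    covering K for g is sent to one covering K for h, and
    alpha |w|^s <= (r^s alpha) |phi w|^s, so the weight of each string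
    does not grow if alpha is replaced by r^s alpha. Hence
    D(h, K, s) <= r^s D(g, K, s): this is [entropy_order_recode].

    It is used twice. From f to f^k, keep every k-th letter of a string of
    length m, which leaves ceil(m / k) letters; here r = k. From f^k to f,
    refine the cover U to the cover whose members are the sets of points with
    a given f-itinerary of length k through U. A letter of this cover stands
    for k letters of U, and since f has period k the same k maps act in each
    block, so that concatenating the codes of the letters gives a valid
    f-string; here r = 1 / k. *)

(** * Unordered sums *)

Lemma le_esum_subset (R : realType) (T : choiceType) (A B : set T)
    (a : T -> \bar R) :
  A `<=` B -> (\esum_(i in A) a i <= \esum_(i in B) a i)%E.
Proof.
move=> AB; apply: ge_ereal_sup => _ [F [finF FA] <-]; apply: ereal_sup_ubound.
by exists F => //; split=> // x /FA /AB.
Qed.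

(** Colliding terms are counted once on the left: the left-hand sum is the sum
    over a set of chosen preimages. *)
Lemma le_esum_image (R : realType) (T T' : choiceType) (A : set T)
    (e : T -> T') (a : T' -> \bar R) :
  (\esum_(j in e @` A) a j <= \esum_(i in A) a (e i))%E.
Proof.
have [[i0 Ai0]|A0] := pselect (A !=set0); last first.
  have -> : A = set0 by apply/eqP/negP => /negP/set0P.
  by rewrite image_set0 !esum_set0.
have /choice[d dP] : forall j, exists i, (e @` A) j -> A i /\ e i = j.
  move=> j; have [[i Ai eij]|] := pselect ((e @` A) j); first by exists i.
  by exists i0.
rewrite (eq_esum (b := fun j => a (e (d j)))); last first.
  by move=> j /dP[_ ->].
rewrite -(esum_image (e @` A) d (a \o e)); last first.
  by move=> j j'; rewrite !inE => /dP[_ {2}<-] /dP[_ {2}<-] ->.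
by apply: le_esum_subset => _ [j /dP[Ad _] <-].
Qed.

(** * Comparison of orders by recoding strings *)

Section entropy_order.
Context {R : realType} {X : topologicalType}.
Implicit Types (g h : nat -> X -> X) (K : set X) (U V : set (set X)).

Lemma entropy_premeasure_ge0 g K (s : R) U alpha N :
  (0 <= entropy_premeasure g K s U alpha N)%E.
Proof.
apply/ereal_infP => _ [G _ <-]; apply: esum_ge0 => w _.
by rewrite lee_fin expR_ge0.
Qed.

Lemma nondecreasing_entropy_premeasure g K (s : R) U alpha :
  {homo entropy_premeasure g K s U alpha : m n / (m <= n)%N >-> (m <= n)%E}.
Proof.
move=> m n mn; apply: ereal_inf_le_tmp => _ [G [cG GU KG Gn] <-].
by exists G => //; split=> // w /Gn; exact: leq_trans.
Qed.

Lemma entropy_measureE g K (s : R) U alpha :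
  entropy_measure g K s U alpha =
  ereal_sup (range (entropy_premeasure g K s U alpha)).
Proof.
apply/cvg_lim => //; apply: ereal_nondecreasing_cvgn.
exact: nondecreasing_entropy_premeasure.
Qed.

(** Since the premeasure is nonnegative and nondecreasing in the length bound,
    the measure vanishes only if the premeasure is zero at every stage, so no
    limit has to be taken in what follows. *)
Lemma entropy_measure_eq0P g K (s : R) U alpha :
  entropy_measure g K s U alpha = 0%E <->
  forall N, (entropy_premeasure g K s U alpha N <= 0)%E.
Proof.
rewrite entropy_measureE; split=> [sup0 N|M0].
  by rewrite -sup0; apply: ereal_sup_ubound; exists N.
apply/eqP; rewrite eq_le; apply/andP; split.
  by apply/ereal_supP => _ [N _ <-].
apply: le_trans (entropy_premeasure_ge0 g K s U alpha 0) _.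
by apply: ereal_sup_ubound; exists 0%N.
Qed.

(** For alpha <= 0 every string weighs at least 1, and a family covering a
    nonempty set has a member. This is what makes all orders nonnegative, and
    it supplies the sign of alpha needed to compare weights. *)
Lemma entropy_measure_eq0_gt0 g K (s : R) U alpha :
  K !=set0 -> entropy_measure g K s U alpha = 0%E -> 0 < alpha.
Proof.
move=> [x Kx] /entropy_measure_eq0P/(_ 0%N) M0; rewrite ltNge; apply/negP => a0.
suff : (1 <= entropy_premeasure g K s U alpha 0)%E.
  by move=> /le_trans/(_ M0); rewrite lee_fin ler10.
apply/ereal_infP => _ [G [_ _ /(_ x Kx)[w Gw _] _] <-].
apply: le_trans (le_esum_subset _ (_ : [set w] `<=` G)); last by move=> _ ->.
rewrite esum_set1 lee_fin ?expR_ge0// -expR0 ler_expR.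
by rewrite mulr_ge0 ?powR_ge0// oppr_ge0.
Qed.

Lemma entropy_cover_ge0 g K (s : R) U :
  K !=set0 -> (0 <= entropy_cover g K s U)%E.
Proof.
move=> K0; apply/ereal_infP => _ [alpha /= m0 <-].
by rewrite lee_fin ltW// (entropy_measure_eq0_gt0 K0 m0).
Qed.

Lemma finite_open_cover_setT : finite_open_cover [set [set: X]].
Proof.
split; first exact: finite_set1.
  by move=> _ ->; exact: openT.
by rewrite bigcup_set1.
Qed.

Lemma entropy_order_ge0 g K (s : R) :
  K !=set0 -> (0 <= entropy_order g K s)%E.
Proof.
move=> K0; apply: le_trans (entropy_cover_ge0 g s [set setT] K0) _.
apply: ereal_sup_ubound; exists [set setT] => //.
exact: finite_open_cover_setT.
Qed.

Lemma entropy_order_eq0_le g h K (s c : R) : K !=set0 ->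
  (entropy_order h K s <= c%:E * entropy_order g K s)%E ->
  entropy_order g K s = 0%E -> entropy_order h K s = 0%E.
Proof.
move=> K0 + g0; rewrite g0 mule0 => h0.
by apply/eqP; rewrite eq_le h0 entropy_order_ge0.
Qed.

(** The image under phi of a family covering K for g covers K for h. Its total
    weight is no larger because no single weight grows and because strings with
    the same recoding are merged. *)
Lemma entropy_premeasure_recode g h K (s : R) U V
    (phi : seq (set X) -> seq (set X)) alpha beta M N :
  (forall w, strings U w -> (M <= size w)%N ->
    [/\ strings V (phi w), string_set g w `<=` string_set h (phi w),
        (N <= size (phi w))%N &
        alpha * (size w)%:R `^ s <= beta * (size (phi w))%:R `^ s]) ->
  (entropy_premeasure h K s V beta N <= entropy_premeasure g K s U alpha M)%E.
Proof.
move=> phiP; apply/ereal_infP => _ [G [cG GU KG GM] <-].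
have {}phiP w : G w -> _ := fun Gw => phiP w (GU _ Gw) (GM _ Gw).
apply: (@le_trans _ _
    (\esum_(v in phi @` G) (expR (- beta * (size v)%:R `^ s))%:E)%E).
  apply: ereal_inf_lbound; exists (phi @` G) => //; split.
  - exact: card_le_trans (card_image_le _ _) cG.
  - by move=> _ [w /phiP[] ? _ _ _ <-].
  - move=> x /KG[w Gw wx]; exists (phi w); first by exists w.
    by case: (phiP _ Gw) => _ /(_ x wx).
  - by move=> _ [w /phiP[] _ _ ? _ <-].
apply: le_trans (le_esum_image _ _ _) _; apply: le_esum => w /phiP[_ _ _ wt].
by rewrite lee_fin ler_expR !mulNr lerN2.
Qed.

(** The bound |w|^s <= r^s |phi w|^s turns every alpha > 0 of zero measure for g
    and U into the exponent r^s alpha of zero measure for h and V. *)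
Lemma entropy_order_recode g h K (s r : R) :
    K !=set0 -> 0 < s -> 0 < r ->
  (forall V, finite_open_cover V -> exists2 U, finite_open_cover U &
    exists phi : seq (set X) -> seq (set X), forall w, strings U w ->
      [/\ strings V (phi w), string_set g w `<=` string_set h (phi w) &
          (size w)%:R <= r * (size (phi w))%:R]) ->
  (entropy_order h K s <= (r `^ s)%:E * entropy_order g K s)%E.
Proof.
move=> K0 s0 r0 recode; apply/ereal_supP => _ [V /recode[U Ucov [phi phiP]] <-].
have rs0 : 0 < r `^ s by rewrite powR_gt0.
apply: (@le_trans _ _ ((r `^ s)%:E * entropy_cover g K s U)%E); last first.
  by rewrite lee_pmul2l//; apply: ereal_sup_ubound; exists U.
rewrite -lee_pdivrMl//; apply/ereal_infP => _ [alpha /= m0 <-].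
have alpha0 := entropy_measure_eq0_gt0 K0 m0.
rewrite lee_pdivrMl// -EFinM; apply: ereal_inf_lbound.
exists (r `^ s * alpha); last by [].
apply/(entropy_measure_eq0P h K s V) => N.
move/entropy_measure_eq0P : m0 => m0.
(* Strings of length at least M > r N are recoded into strings of length at
   least N. *)
set M := (Num.truncn (r * N%:R)).+1.
apply: le_trans (m0 M).
apply: (@entropy_premeasure_recode _ _ _ _ _ _ phi) => w Uw Mw.
have [Vw gh wr] := phiP w Uw; split=> //.
  rewrite -(ler_nat R) -(ler_pM2l r0); apply: le_trans wr.
  apply: ltW; apply: lt_le_trans (truncnS_gt _) _.
  by rewrite ler_nat.
rewrite mulrC [leRHS]mulrAC ler_pM2r//.
have r_ge0 := ltW r0; rewrite -powRM//.
by apply: ge0_ler_powR (ltW s0) _ _ _ _ wr; rewrite ?nnegrE ?mulr_ge0.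
Qed.

End entropy_order.

(** * Iterates of a sequence of maps and of its powers *)

Section seqcomp_theory.
Context {X : Type}.
Implicit Types f : nat -> X -> X.

Lemma seqcompD f i m n :
  seqcomp f i (m + n) = seqcomp f (i + m) n \o seqcomp f i m.
Proof.
elim: n => [|n IH]; first by rewrite addn0.
by rewrite addnS /= IH addnA.
Qed.

Lemma seqcomp_seqpow f k n : seqcomp (seqpow f k) 0 n = seqcomp f 0 (n * k).
Proof. by elim: n => //= n ->; rewrite mulSnr seqcompD. Qed.

Lemma seqcomp_period f k n j :
  has_period f k -> seqcomp f (n * k) j = seqcomp f 0 j.
Proof.
move=> [_ fk]; elim: j => //= j ->; congr (_ \o _).
by elim: n => //= n <-; rewrite mulSnr addnAC fk.
Qed.

End seqcomp_theory.

(** * The cover by itineraries of length k *)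

Section refinement.
Context {X : topologicalType}.
Implicit Types (f : nat -> X -> X) (U : set (set X)).

Lemma continuous_seqcomp f i j :
  (forall n, continuous (f n)) -> continuous (seqcomp f i j).
Proof.
move=> fc; elim: j => [|j IH] x /=; first exact: cvg_id.
exact: (continuous_comp (IH x) (fc _ _)).
Qed.

Lemma string_set_rcons f w B :
  string_set f (rcons w B) = string_set f w `&` seqcomp f 0 (size w) @^-1` B.
Proof.
apply/seteqP; split=> x.
  move=> wx; split=> [j jw|].
    by have := wx j; rewrite nth_rcons jw size_rcons ltnS; apply; exact: ltnW.
  by have := wx (size w); rewrite nth_rcons ltnn eqxx size_rcons; apply.
move=> [wx Bx] j; rewrite size_rcons ltnS leq_eqVlt nth_rcons.
by have [->|_ /= jw] := eqVneq j (size w); rewrite ?ltnn// jw; exact: wx.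
Qed.

(** The join of the preimages of U under the first k iterates f_1^0, ...,
    f_1^(k-1). Describing its members by strings keeps at hand the k letters
    that each of them encodes. *)
Definition itinerary_cover f U k : set (set X) :=
  string_set f @` [set w | strings U w /\ size w = k].

Lemma itinerary_coverS f U k :
  itinerary_cover f U k.+1 =
  [set A `&` seqcomp f 0 k @^-1` B | A in itinerary_cover f U k & B in U].
Proof.
apply/seteqP; split=> [_ [w [Uw sw] <-]|_ [_ [w [Uw <-] <-] [B UB <-]]].
  case/lastP: w Uw sw => // w B Uw; rewrite size_rcons => -[sw].
  exists (string_set f w).
    exists w => //; split=> // C Cw.
    by apply: Uw; rewrite mem_rcons inE Cw orbT.
  exists B; first by apply: Uw; rewrite mem_rcons mem_head.
  by rewrite string_set_rcons sw.
exists (rcons w B); last by rewrite string_set_rcons.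
split; last by rewrite size_rcons.
by move=> C; rewrite mem_rcons inE => /predU1P[->|/Uw].
Qed.

Lemma finite_open_cover_itinerary f U k :
  (forall i, continuous (f i)) -> finite_open_cover U ->
  finite_open_cover (itinerary_cover f U k).
Proof.
move=> fc [finU openU coverU]; elim: k => [|k [finV openV coverV]].
  suff -> : itinerary_cover f U 0 = [set setT] by exact: finite_open_cover_setT.
  have s0 : string_set f [::] = setT by apply/seteqP; split.
  apply/seteqP; split=> [_ [w [_ /size0nil->] <-]|_ ->]; first by rewrite s0.
  by exists [::].
rewrite itinerary_coverS; split; first exact: finite_image2.
  move=> _ [A VA [B UB <-]]; apply: openI; first exact: openV.
  have /continuousP := continuous_seqcomp (i := 0) (j := k) fc.
  by apply; exact: openU.
apply/seteqP; split=> // x _.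
have [A VA Ax] : (\bigcup_(A in itinerary_cover f U k) A) x by rewrite coverV.
have [B UB Bx] : (\bigcup_(B in U) B) (seqcomp f 0 k x) by rewrite coverU.
by exists (A `&` seqcomp f 0 k @^-1` B) => //; exists A => //; exists B.
Qed.

Lemma strings_mkseq U (F : nat -> set X) n :
  (forall j, (j < n)%N -> U (F j)) -> strings U (mkseq F n).
Proof.
by move=> UF V /mapP[j]; rewrite mem_iota add0n => /UF + ->.
Qed.

Lemma strings_nth U w j : strings U w -> (j < size w)%N -> U (nth set0 w j).
Proof. by move=> Uw jw; apply: Uw; exact: mem_nth. Qed.

End refinement.

(** * The orders of a sequence and of its k-th power *)

Section powers.
Context {R : realType} {X : topologicalType}.
Implicit Types (f : nat -> X -> X) (K : set X).

(** A point following w under f follows the letters of w at the times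
    0, k, 2k, ... under f^k. *)
Lemma entropy_order_seqpow_le f K k (s : R) :
    (0 < k)%N -> K !=set0 -> 0 < s ->
  (entropy_order (seqpow f k) K s <= (k%:R `^ s)%:E * entropy_order f K s)%E.
Proof.
move=> k0 K0 s0; apply: entropy_order_recode => //; first by rewrite ltr0n.
move=> U Ucov; exists U => //.
(* The number of sampled letters is |w| / k rounded up: this gives
   |w| <= k |phi w| for every length, also for those that k does not divide. *)
exists (fun w => mkseq (fun j => nth set0 w (j * k)) ((size w + k.-1) %/ k)).
move=> w Uw.
have sampleP j : (j < (size w + k.-1) %/ k)%N -> (j * k < size w)%N.
  by rewrite leq_divRL// mulSn; lia.
split.
- by apply: strings_mkseq => j /sampleP; exact: strings_nth.
- move=> x wx j; rewrite size_mkseq => jw.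
  by rewrite nth_mkseq// seqcomp_seqpow; apply: wx; exact: sampleP.
- rewrite size_mkseq -natrM ler_nat mulnC.
  by have := ltn_ceil (size w + k.-1) k0; rewrite mulSn; lia.
Qed.

(** A point lies in a member of the itinerary cover at the n-th step of f^k if
    it follows the code of that member during the n-th block of k steps of f;
    periodicity makes the maps of that block equal to the first k maps. *)
Lemma entropy_order_le_seqpow f K k (s : R) :
    (forall i, continuous (f i)) -> has_period f k -> K !=set0 -> 0 < s ->
  (entropy_order f K s <=
    ((k%:R^-1) `^ s)%:E * entropy_order (seqpow f k) K s)%E.
Proof.
move=> fc fk K0 s0; have k0 : (0 < k)%N by case: fk.
apply: entropy_order_recode => //; first by rewrite invr_gt0 ltr0n.
move=> U Ucov; exists (itinerary_cover f U k).
  exact: finite_open_cover_itinerary.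
have /choice[code codeP] : forall A, exists w, itinerary_cover f U k A ->
    [/\ strings U w, size w = k & string_set f w = A].
  move=> A; have [[w [Uw wk] wA]|] := pselect (itinerary_cover f U k A).
    by exists w.
  by exists [::].
exists (fun w => mkseq (fun n => nth set0 (code (nth set0 w (n %/ k))) (n %% k))
                       (size w * k)) => w Uw.
have blockP n :
    (n < size w * k)%N -> itinerary_cover f U k (nth set0 w (n %/ k)).
  by move=> nw; apply: strings_nth => //; rewrite ltn_divLR.
split.
- apply: strings_mkseq => n /blockP/codeP[Uc ck _].
  by apply: strings_nth; rewrite ?ck ?ltn_mod.
- move=> x wx n; rewrite size_mkseq => nw; rewrite nth_mkseq//.
  have [_ ck cA] := codeP _ (blockP _ nw).
  (* Time n lies at position n %% k of the block number n %/ k. *)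
  rewrite [X in seqcomp f 0 X](divn_eq n k) seqcompD add0n seqcomp_period//=.
  have : string_set f (code (nth set0 w (n %/ k)))
      (seqcomp (seqpow f k) 0 (n %/ k) x).
    by rewrite cA; apply: wx; rewrite ltn_divLR.
  by rewrite seqcomp_seqpow; apply; rewrite ck ltn_mod.
- by rewrite size_mkseq natrM mulrC mulfK// pnatr_eq0 -lt0n.
Qed.

End powers.

Theorem theorem3p18 (R : realType) (X : topologicalType)
    (hX : compact [set: X]) (f : nat -> X -> X)
    (hf : forall i : nat, continuous (f i)) (K : set X) (hK : K !=set0)
    (k : nat) (hk : has_period f k) :
  entropy_dim R (seqpow f k) K = entropy_dim R f K.
Proof.
have k0 : (0 < k)%N by case: hk.
have E : [set s : R | 0 < s /\ entropy_order (seqpow f k) K s = 0%E] =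
    [set s : R | 0 < s /\ entropy_order f K s = 0%E].
  apply/seteqP; split=> s [s0 order0]; (split; first exact: s0).
    exact: entropy_order_eq0_le hK (entropy_order_le_seqpow hf hk hK s0) order0.
  exact: entropy_order_eq0_le hK (entropy_order_seqpow_le f k0 hK s0) order0.
by rewrite /entropy_dim E.
Qed.
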